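(* Fix $d\ge 1$ and a finite $2d$-regular graph $G_B=G(\sigma_1,\ldots,\sigma_d)$, where $\sigma_1,\ldots,\sigma_d$ are permutations of $V(G_B)$. For each $n$, choose $\pi_1,\ldots,\pi_d\in S_n$ uniformly and independently at random, and let $H=G((\sigma_1,\pi_1),\ldots,(\sigma_d,\pi_d))$ on vertex set $V(G_B)\times[n]$. Then, as $n\to\infty$, $$\mathbb{E}[\mu(H)]\le 32^{1/4}\, d^{3/4}+o(1).$$ Consequently, $\mu(H)=O(d^{3/4})$ asymptotically almost surely (with probability tending to $1$ as $n\to\infty$).
   Context: For permutations $\tau_1,\ldots,\tau_d$ of a finite set $V$, $G(\tau_1,\ldots,\tau_d)$ is the $2d$-regular multigraph on $V$ with edge multiset $\{v\,\tau_i(v): v\in V, i=1,\ldots,d\}$ (a fixed point $\tau_i(v)=v$ gives a loop counted twice in the degree); its adjacency matrix is $\sum_{i=1}^d (P_{\tau_i}+P_{\tau_i}^{-1})$ where $P_{\tau}$ is the permutation matrix of $\tau$. Here $(\sigma_i,\pi_i)$ denotes the permutation $(v,u)\mapsto(\sigma_i(v),\pi_i(u))$ of $V(G_B)\times[n]$. The projection $V(H)\to V(G_B)$ is a covering map, and every eigenfunction $f$ of $G_B$ with eigenvalue $\lambda$ lifts to the eigenfunction $f\circ\mathrm{proj}$ of $H$ with eigenvalue $\lambda$; these are the old eigenvalues. The new eigenvalues of $H$ are the eigenvalues of the adjacency matrix of $H$ restricted to the orthogonal complement of the space of functions on $V(H)$ that are constant on the fibers of the projection to $V(G_B)$ (equivalently,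 the spectrum of $H$ with the spectrum of $G_B$ removed as multisets). $\mu(H)$ denotes the largest absolute value of a new eigenvalue of $H$. *)

(* Defs.v *)
From HB Require Import structures.
From mathcomp Require Import all_boot all_order all_algebra all_fingroup.
From mathcomp Require Import all_classical all_reals all_analysis.

Set Implicit Arguments.
Unset Strict Implicit.
Unset Printing Implicit Defensive.

Import Order.TTheory GRing.Theory Num.Theory.
Local Open Scope classical_set_scope.
Local Open Scope ring_scope.

(* Functions on a finite type T are column vectors indexed by 'I_#|T|, through
   the bijection enum_val : 'I_#|T| -> T. *)
Definition permutation_mx (R : realType) (T : finType) (t : {perm T}) :
    'M[R]_#|T| :=
  \matrix_(x, y) (t (enum_val x) == enum_val y)%:R.

(* Adjacency matrix of the 2d-regular multigraph G(tau_1, ..., tau_d). A fixed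
   point of tau_i contributes 2 to the diagonal. *)
Definition adjacency_mx (R : realType) (T : finType) (d : nat)
    (tau : 'I_d -> {perm T}) : 'M[R]_#|T| :=
  \sum_(i < d) (permutation_mx R (tau i) + invmx (permutation_mx R (tau i))).

Definition pair_map (V U : finType) (s : {perm V}) (p : {perm U})
    (x : V * U) : V * U := (s x.1, p x.2).

Lemma pair_map_inj (V U : finType) (s : {perm V}) (p : {perm U}) :
  injective (pair_map s p).
Proof. by move=> [v u] [v' u'] [/perm_inj -> /perm_inj ->]. Qed.

Definition pair_perm (V U : finType) (s : {perm V}) (p : {perm U}) :
  {perm V * U} := perm (@pair_map_inj V U s p).

Definition lift_perms (V : finType) (d n : nat) (sigma : 'I_d -> {perm V})
    (p : {ffun 'I_d -> 'S_n}) : 'I_d -> {perm V * 'I_n} :=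
  fun i => pair_perm (sigma i) (p i).

Definition fiber_constant (R : realType) (V U : finType)
    (g : 'cV[R]_#|{: V * U}|) : Prop :=
  forall x y : 'I_#|{: V * U}|,
    (enum_val x).1 = (enum_val y).1 -> g x 0 = g y 0.

Definition new_function (R : realType) (V U : finType)
    (f : 'cV[R]_#|{: V * U}|) : Prop :=
  forall g, fiber_constant g -> \sum_x f x 0 * g x 0 = 0.

(* The adjacency matrix is real symmetric and preserves the space of new
   functions, so its restriction to that space has only real eigenvalues. *)
Definition new_eigenvalues (R : realType) (V : finType) (d n : nat)
    (sigma : 'I_d -> {perm V}) (p : {ffun 'I_d -> 'S_n}) : set R :=
  [set a | exists f : 'cV[R]_#|{: V * 'I_n}|,
     [/\ f != 0, new_function f &
         adjacency_mx R (lift_perms sigma p) *m f = a *: f]].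
Arguments new_eigenvalues R {V d n} sigma p.

(* The supremum of a nonempty finite set, hence a maximum, as soon as V is
   nonempty and n >= 2; otherwise there are no new eigenvalues, and mu = 0
   because sup set0 = 0. *)
Definition mu (R : realType) (V : finType) (d n : nat)
    (sigma : 'I_d -> {perm V}) (p : {ffun 'I_d -> 'S_n}) : R :=
  sup [set `|a| | a in new_eigenvalues R sigma p].

(* A uniform element of {ffun 'I_d -> 'S_n} is a d-tuple of independent uniform
   elements of S_n. *)
Definition uniform_expectation (R : realType) (T : finType) (X : T -> R) : R :=
  (\sum_(w : T) X w) / #|T|%:R.

Definition uniform_probability (R : realType) (T : finType) (E : pred T) : R :=
  #|E|%:R / #|T|%:R.

(* Main.v *)
Require Import Defs.
From HB Require Import structures.
From mathcomp Require Import all_boot all_order all_algebra all_fingroup.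
From mathcomp Require Import all_classical all_reals all_analysis.
From mathcomp Require Import zify ring lra.

Set Implicit Arguments.
Unset Strict Implicit.
Unset Printing Implicit Defensive.

Import Order.TTheory GRing.Theory Num.Theory.
Import numFieldNormedType.Exports.

(* The Broder-Shamir trace method. A new eigenvalue [a] satisfies
   [a ^ (2k) <= T], where [T] is the squared Frobenius norm of the [k]-th power
   of the adjacency matrix restricted to the new functions; [T] is the sum over
   pairs of words of length [k], that is over words [w] of length [2k] in the
   permutations and their inverses, of [fix(sigma_w) (fix(pi_w) - 1)].
   - If the free reduction of [w] is trivial or conjugate to a proper power,
     [fix(pi_w) <= n] suffices: such a word is encoded by its push/pop pattern
     in the stack algorithm for free reduction and by [k] letters, so there are
     at most [(2k+1)^3 (8d)^k] of them.
   - Otherwise [w] is conjugate to a primitive cyclically reduced word [b] and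
     [E fix(pi_b) <= 1 + O(k^4 / n)]. Indeed a closed walk spelling [b] either
     visits distinct vertices, or, after rotating [b], closes a first cycle of
     length [i < |b|]; as [b] is not a power it must leave this cycle along an
     unrevealed edge and later hit a known vertex again, so that it spans a
     graph with more edges than vertices.
   Hence [E mu^(2k) <= |V| ((2k+1)^3 (8d)^k n + (2d)^(2k) O(k^4) / n)], and
   taking [k] least with [(d/2)^k >= n^2] balances the two terms at
   [((8d)^(1/2) (d/2)^(1/4))^(2k) = (32^(1/4) d^(3/4))^(2k)]. For [d <= 2] the
   bound [mu <= 2d] is enough. *)

(** * Words and free reduction *)

Section Words.
Variable d : nat.

Definition letter : predArgType := ('I_d * bool)%type.
Implicit Types (s : letter) (w u b : seq letter).

Definition linv s : letter := (s.1, ~~ s.2).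

Lemma linvK : involutive linv.
Proof. by case=> i []. Qed.

Lemma linv_neq s : s != linv s.
Proof. by case: s => i [] /=; rewrite /linv xpair_eqE andbF. Qed.

Definition winv w := rev (map linv w).

Lemma winvK : involutive winv.
Proof.
by move=> w; rewrite /winv map_rev revK -map_comp map_id_in // => x _; exact: linvK.
Qed.

Lemma size_winv w : size (winv w) = size w.
Proof. by rewrite size_rev size_map. Qed.

Definition nonbacktracking s (t : letter) := t != linv s.

Definition push s w :=
  if w is t :: w' then if t == linv s then w' else s :: w else [:: s].

(** The word is read from right to left: the stack is the reduced form of the suffix read so far,
    top first. *)
Definition red w := foldr push [::] w.

Lemma red_sorted w : sorted nonbacktracking (red w).
Proof.
elim: w => //= s w; case: (red w) => [|t w'] //= IH.
by case: eqP => [_|/eqP nts] /=; [apply: path_sorted IH | rewrite /nonbacktracking nts].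
Qed.

Lemma size_red w : size (red w) <= size w.
Proof.
elim: w => //= s w IH; case: (red w) IH => [|t w'] //= IH.
by case: eqP => _ /=; lia.
Qed.

(* Inverse of the stack algorithm [red]: [true] records a push, and [ls] lists
   the letters that were popped. *)
Fixpoint unred (ps : seq bool) (st ls : seq letter) : seq letter :=
  match ps with
  | [::] => [::]
  | true :: ps' => if st is s :: st' then s :: unred ps' st' ls else [::]
  | false :: ps' =>
      if ls is l :: ls' then linv l :: unred ps' (l :: st) ls' else [::]
  end.

(** The operations are undone last one first: a push left its letter on top of the stack, and a
    popped [l] was cancelled by [linv l]. Each pop accounts for two letters of [w]. *)
Lemma redK w : exists ps ls,
  [/\ size ps = size w, size ls = count negb ps,
      2 * size ls + size (red w) = size w & unred ps (red w) ls = w].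
Proof.
elim: w => [|s w [ps [ls [sps sls szr un]]]]; first by exists [::], [::].
rewrite /= /push; case E: (red w) => [|t w'].
  by exists (true :: ps), ls; rewrite /= -E un sps sls; split=> //; rewrite E /= in szr; lia.
case: eqP => [ts|_].
  exists (false :: ps), (t :: ls); rewrite /= -E un sps sls ts linvK.
  by split=> //; rewrite E /= in szr; lia.
by exists (true :: ps), ls; rewrite /= -E un sps sls; split=> //; rewrite E /= in szr *; lia.
Qed.

(** Strip the first and last letters as long as they are mutually inverse. *)
Lemma cyclic_reduction w : sorted nonbacktracking w ->
  exists u b, w = u ++ b ++ winv u /\ path.cycle nonbacktracking b.
Proof.
have [k] := ubnP (size w); elim: k w => // k IH w szw srt.
case: w szw srt => [|s w] szw srt; first by exists [::], [::].
case/lastP: w szw srt => [|w t] szw srt.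
  by exists [::], [:: s]; split=> //=; rewrite /nonbacktracking linv_neq.
have [ts|nts] := eqVneq t (linv s).
  have [||u [b [-> cb]]] := IH w.
  - by move: szw; rewrite /= size_rcons; lia.
  - by move: srt; rewrite /= rcons_path => /andP [/path_sorted].
  exists (s :: u), b; split=> //.
  by rewrite ts /winv /= rev_cons -!rcons_cat.
exists [::], (s :: rcons w t); rewrite cats0; split=> //=.
rewrite rcons_path; move: srt => /= ->; rewrite last_rcons /nonbacktracking /=.
by apply: contraNneq nts => ->; rewrite linvK.
Qed.

(** Not a proper power: for a proper divisor [i] of the length, [rot i b == b] means that [b] is a
    power of its prefix of length [i]. *)
Definition primitive_word b :=
  forall i, 0 < i < size b -> i %| size b -> rot i b != b.

Lemma periodic_nth (s0 : letter) b i : 0 < i ->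
  (forall t, i <= t < size b -> nth s0 b t = nth s0 b (t - i)) ->
  forall t, t < size b -> nth s0 b t = nth s0 b (t %% i).
Proof.
move=> i0 per t; have [k] := ubnP t; elim: k t => // k IH t ltk tb.
have [ti|it] := ltnP t i; first by rewrite modn_small.
rewrite per ?it // IH; [|lia|lia].
by rewrite -[in RHS](subnK it) modnDr.
Qed.

Lemma rot_periodic (s0 : letter) b i : 0 < i < size b -> i %| size b ->
  (rot i b == b) <->
  (forall t, i <= t < size b -> nth s0 b t = nth s0 b (t - i)).
Proof.
move=> /andP[i0 ib] /dvdnP [q qb]; split=> [/eqP E t /andP[it tb]|per].
  rewrite -{2}E /rot nth_cat size_drop nth_drop.
  by rewrite (_ : t - i < size b - i) 1?subnKC //; lia.
apply/eqP/(@eq_from_nth _ s0); first by rewrite size_rot.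
rewrite size_rot => t tb; rewrite /rot nth_cat size_drop nth_drop.
case: ltnP => tbi; first by rewrite per; [congr nth; lia|lia].
rewrite nth_take; last by lia.
rewrite (periodic_nth i0 per tb) (periodic_nth i0 per (t := _ - _)); last by lia.
(* As [size b = q * i], wrapping around shifts [t] by a multiple of [i]. *)
congr nth; have {2}-> : t = q.-1 * i + (t - (size b - i)) by nia.
by rewrite modnMDl.
Qed.

(* Words whose reduced form is trivial or conjugate to a proper power. *)
Definition power_word (s0 : letter) w := exists u b i,
  [/\ red w = u ++ b ++ winv u, 2 * i <= size b, 0 < size b -> 0 < i &
      b = mkseq (fun t => nth s0 b (t %% i)) (size b)].

Lemma reduced_form_dichotomy (s0 : letter) w :
  power_word s0 w \/
  exists u b, [/\ red w = u ++ b ++ winv u, path.cycle nonbacktracking b,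
    0 < size b & primitive_word b].
Proof.
have [u [b [rw cb]]] := cyclic_reduction (red_sorted w).
have [/size0nil b0|b0] := posnP (size b).
  by left; exists u, b, 0; rewrite rw b0.
have [[i [iP idvd rib]]|nper] :=
  pselect (exists i, [/\ 0 < i < size b, i %| size b & rot i b == b]).
  have /andP[i0 ib] := iP; left; exists u, b, i; split=> //.
    (* A proper divisor is at most half of the length. *)
    by case/dvdnP: idvd => q qb; case: q qb => [|[|q]]; nia.
  apply: (@eq_from_nth _ s0) => [|t tb]; first by rewrite size_mkseq.
  rewrite nth_mkseq //; apply: periodic_nth => //.
  exact/rot_periodic.
right; exists u, b; split=> // i iP idvd; apply/negP => rib.
by apply: nper; exists i.
Qed.

Definition power_code k : finType :=
  ((2 * k).-tuple bool * k.-tuple letter *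
   ('I_(2 * k).+1 * 'I_(2 * k).+1 * 'I_(2 * k).+1))%type.

(* A code records the push/pop pattern, the popped letters followed by the
   conjugator and one period, and the lengths of the last two and of the
   power: at most half of the letters of the word have to be stored. *)
Definition power_decode s0 k (c : power_code k) : seq letter :=
  let: (ps, ls, (a, i, m)) := c in
  let j := count negb ps in
  let u := take a (drop j ls) in
  let per := drop a (drop j ls) in
  unred ps (u ++ mkseq (fun t => nth s0 per (t %% i)) m ++ winv u) (take j ls).

Lemma power_wordP s0 k w : size w = 2 * k -> power_word s0 w ->
  exists c : power_code k, w = power_decode s0 c.
Proof.
move=> sw [u [b [i [rw ib i0 bE]]]].
have [ps [ls [sps sls szr un]]] := redK w.
have szrw : size (red w) = 2 * size u + size b.
  by rewrite rw !size_cat size_winv; lia.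
pose t0 := ls ++ u ++ take i b.
(* Half of [2 * size ls + 2 * size u + size b = 2 * k], with [2 * i <= size b]; the tuple is then
   padded with [s0]. *)
have st0 : size t0 <= k.
  by rewrite !size_cat size_take_min; lia.
pose t := t0 ++ nseq (k - size t0) s0.
have st : size t == k by rewrite size_cat size_nseq subnKC.
have sps' : size ps == 2 * k by rewrite sps sw.
have ha : size u < (2 * k).+1 by lia.
have hi : i < (2 * k).+1 by lia.
have hm : size b < (2 * k).+1 by lia.
exists (Tuple sps', Tuple st, (Ordinal ha, Ordinal hi, Ordinal hm)).
rewrite /power_decode /= -sls /t /t0 -!catA drop_size_cat // take_size_cat //.
rewrite drop_size_cat // take_size_cat //.
rewrite -[LHS]un rw; congr (unred ps (u ++ _ ++ _) ls).
rewrite [LHS]bE; apply/eq_in_map => j; rewrite mem_iota add0n => /andP[_ jb].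
have ip : 0 < i by apply: i0; lia.
have jm : j %% i < i by rewrite ltn_mod.
rewrite nth_cat size_take_min nth_take //.
by rewrite (_ : _ < minn i (size b)) //; lia.
Qed.

(** A pair of words of length [k] is recovered from the concatenated word, and that word from its
    code. The factor [8 * d] is [2 ^ 2] for two pattern bits times [2 * d] for one stored letter. *)
Lemma card_power_pairs s0 k (A : {set k.-tuple letter * k.-tuple letter}) :
  (forall ww, ww \in A -> power_word s0 (ww.1 ++ winv ww.2)) ->
  #|A| <= (2 * k).+1 ^ 3 * (8 * d) ^ k.
Proof.
move=> Ap; pose f (ww : k.-tuple letter * k.-tuple letter) := val ww.1 ++ winv ww.2.
have finj : injective f.
  move=> [w1 w2] [v1 v2] /eqP; rewrite /f /= eqseq_cat ?size_tuple // => /andP[/eqP E1 /eqP E2].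
  by rewrite (val_inj E1) (val_inj (can_inj winvK E2)).
have -> : (2 * k).+1 ^ 3 * (8 * d) ^ k = #|power_code k|.
  rewrite !card_prod !card_tuple !card_ord card_prod card_ord !card_bool.
  rewrite expnM -expnMn mulnC (_ : 8 * d = 2 ^ 2 * (d * 2)); last by lia.
  by congr (_ * _); rewrite !expnS expn0; lia.
rewrite cardE -(size_map f) cardE -(size_map (@power_decode s0 k)).
apply: uniq_leq_size; first by rewrite map_inj_uniq ?enum_uniq.
move=> w /mapP[ww]; rewrite mem_enum => /Ap pw ->.
have [|c cE] := power_wordP (k := k) _ pw; first by rewrite size_cat size_winv !size_tuple; lia.
by rewrite /f cE; apply: map_f; rewrite mem_enum.
Qed.

End Words.

(** * Action of words on a finite set and their fixed points *)

Section Walks.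
Variables (d : nat) (T : finType).
Implicit Types (p : 'I_d -> {perm T}) (s : letter d) (w u b : seq (letter d)).

Definition letter_perm p s : {perm T} :=
  if s.2 then p s.1 else (p s.1)^-1%g.

Definition walk p w (x : T) := foldl (fun y s => letter_perm p s y) x w.

Lemma letter_perm_linv p s : letter_perm p (linv s) = (letter_perm p s)^-1%g.
Proof. by case: s => i []; rewrite /letter_perm /= ?invgK. Qed.

Lemma walk_cat p w u x : walk p (w ++ u) x = walk p u (walk p w x).
Proof. exact: foldl_cat. Qed.

Lemma walk_winvK p w : cancel (walk p w) (walk p (winv w)).
Proof.
elim: w => //= s w IH x.
by rewrite /winv /= rev_cons -cats1 walk_cat -/(winv w) IH /= letter_perm_linv permK.
Qed.

Lemma walk_inj p w : injective (walk p w).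
Proof. exact: can_inj (walk_winvK p w). Qed.

Lemma walk_red p w x : walk p (red w) x = walk p w x.
Proof.
elim: w x => //= s w IH x; rewrite -IH /push; case: (red w) => [|t w'] //=.
by case: eqP => //= ->; rewrite letter_perm_linv permK.
Qed.

Definition fixpoints p w := [set x | walk p w x == x].

(** Walking along [u] carries the fixed points of [w] onto those of [b]. *)
Lemma card_fixpoints_conj p w u b : red w = u ++ b ++ winv u ->
  #|fixpoints p w| = #|fixpoints p b|.
Proof.
move=> rw; rewrite -(card_imset _ (@walk_inj p u)); congr #|pred_of_set _|.
have wE x : walk p w x = walk p (winv u) (walk p b (walk p u x)).
  by rewrite -walk_red rw !walk_cat.
apply/setP => y; apply/imsetP/idP => [[x + ->]|].
  rewrite !inE wE => /eqP E; apply/eqP.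
  by rewrite -[LHS](walk_winvK p (winv u)) winvK E.
rewrite inE => /eqP E.
have uK : walk p u (walk p (winv u) y) = y.
  by rewrite -[in X in walk p X](winvK u) walk_winvK.
by exists (walk p (winv u) y); rewrite ?inE ?wE uK ?E.
Qed.

Lemma walk_agree p w u x :
  (walk p w x == walk p u x) = (x \in fixpoints p (w ++ winv u)).
Proof.
rewrite inE walk_cat; apply/eqP/eqP => [->|E]; first exact: walk_winvK.
by apply: (@walk_inj p (winv u)); rewrite E walk_winvK.
Qed.

End Walks.

(** * Counting permutations with prescribed values *)

(** Probability bounds are kept in natural numbers: [c] plays the role of a denominator. *)
Lemma union_bound (I T : finType) (A : {set T}) (F : I -> {set T}) (c K : nat) :
  (forall x, x \in A -> exists i, x \in F i) ->
  (forall i, #|F i| * c <= K) -> #|A| * c <= #|I| * K.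
Proof.
move=> AF FK; rewrite -[X in _ <= X]sum_nat_const.
have AU : A \subset \bigcup_i F i.
  by apply/fintype.subsetP => x /AF [i xi]; apply/finset.bigcupP; exists i.
have UF : #|\bigcup_i F i| <= \sum_i #|F i|.
  elim/big_rec2: _ => [|i k B _ IH]; first by rewrite cards0.
  by rewrite (leq_trans (leq_card_setU _ _)) // leq_add2l.
apply: (@leq_trans (\sum_i #|F i| * c)).
  by rewrite -big_distrl leq_mul2r (leq_trans (subset_leq_card AU)) ?UF ?orbT.
by apply: leq_sum.
Qed.

Section Extensions.
Variables (d n : nat).
Local Notation letter := (letter d).
Local Notation perms := {ffun 'I_d -> 'S_n}.

(* An edge [(s, y, z)] stands for the constraint that [s] maps [y] to [z]. *)
Definition edge_of (U : Type) : Type := (letter * U * U)%type.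

Definition extensions (C : seq (edge_of 'I_n)) : {set perms} :=
  [set p : perms | all (fun c : edge_of 'I_n => letter_perm p c.1.1 c.1.2 == c.2) C].

(* The image of the source of [c] under its letter is not forced by [c']. *)
Definition free_from (U : eqType) (c' c : edge_of U) :=
  ((c'.1.1 != c.1.1) || (c'.1.2 != c.1.2)) &&
  ((c'.1.1 != linv c.1.1) || (c'.2 != c.1.2)).

Arguments free_from {U}.

Definition update (p : perms) (s : letter) (q : 'S_n) : perms :=
  [ffun i => if i == s.1 then if s.2 then q else q^-1%g else p i].

Lemma update_letter p s q : letter_perm (update p s q) s = q.
Proof.
by rewrite /letter_perm /update ffunE eqxx; case: s.2; rewrite ?invgK.
Qed.

Lemma update_other p s q t : t != s -> t != linv s ->
  letter_perm (update p s q) t = letter_perm p t.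
Proof.
case: s t => i b [j c]; rewrite /linv !xpair_eqE /letter_perm /update !ffunE /=.
by case: eqP => //=; case: b c => [] [].
Qed.

Lemma update_inj p p' s q q' :
  update p s q = update p' s q' -> letter_perm p s = letter_perm p' s -> p = p'.
Proof.
move=> E E'; apply/ffunP => i; have := congr1 (fun q : perms => q i) E; rewrite !ffunE.
case: eqP => // -> _; move: E'; rewrite /letter_perm.
by case: s.2 => // /invg_inj.
Qed.

(** Given [C], the value [z] at [y] is at most as likely as any of the at least [n - size C] values
    still available. *)
Lemma card_extensions_cons (C : seq (edge_of 'I_n)) s y z : all (free_from^~ (s, y, z)) C ->
  #|extensions ((s, y, z) :: C)| * (n - size C) <= #|extensions C|.
Proof.
move=> /allP fr.
pose avoids (x : 'I_n) (c : edge_of 'I_n) :=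
  ((c.1.1 != s) || (c.2 != x)) && ((c.1.1 != linv s) || (c.1.2 != x)).
(* The available values; each constraint excludes at most one, the vertex picked by [f] below. *)
pose Z := [set x | all (avoids x) C].
have Zn : n - size C <= #|Z|.
  rewrite leq_subLR addnC -[X in X <= _]card_ord -(cardsC Z) leq_add2l.
  pose f (c : edge_of 'I_n) := if c.1.1 == s then c.2 else c.1.2.
  rewrite -(size_map f) cardE; apply: uniq_leq_size; first exact: enum_uniq.
  move=> x; rewrite mem_enum !inE -has_predC => /hasP[c cC /=].
  rewrite /avoids negb_and !negb_or !negbK => /orP[]/andP[/eqP E /eqP E'].
    by apply/mapP; exists c => //; rewrite /f E eqxx.
  by apply/mapP; exists c => //; rewrite /f E eq_sym (negbTE (linv_neq s)).
have [zZ|zZ] := boolP (z \in Z); last first.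
  suff -> : extensions ((s, y, z) :: C) = finset.set0 by rewrite cards0.
  apply/setP => p; rewrite !inE /=; apply/negP => /andP[/eqP pz /allP pC].
  move: zZ; rewrite inE -has_predC => /hasP[c cC /=].
  have /eqP pc := pC c cC; have /andP[/= f1 f2] := fr c cC.
  rewrite /avoids negb_and !negb_or !negbK => /orP[]/andP[/eqP E /eqP E'].
    move: f1; rewrite E eqxx /= => /eqP; apply.
    by apply: (@perm_inj _ (letter_perm p s)); rewrite -E pc E' E pz.
  move: f2; rewrite E eqxx /= => /eqP; apply.
  by rewrite -pc E letter_perm_linv E' -pz permK.
have le_z x : x \in Z ->
    #|extensions ((s, y, z) :: C)| <= #|extensions ((s, y, x) :: C)|.
  (* Composing with the transposition of [z] and [x] redirects [y] from [z] to [x] and preserves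
     [C], since both values are available. *)
  move=> xZ; pose h p := update p s (letter_perm p s * tperm z x)%g.
  have hinj : injective h.
    move=> p p' E; apply: update_inj (E) _.
    have := congr1 (fun q : perms => letter_perm q s) E.
    by rewrite /h !update_letter => /mulIg.
  rewrite -(card_imset _ hinj); apply/subset_leq_card/fintype.subsetP => _ /imsetP[p + ->].
  rewrite !inE /= => /andP[/eqP pz /allP pC].
  rewrite update_letter permM pz tpermL eqxx /=; apply/allP => c cC.
  have /eqP pc := pC c cC.
  move: zZ xZ; rewrite !inE => /allP/(_ c cC)/andP[z1 z2] /allP/(_ c cC)/andP[x1 x2].
  have [E|ns] := eqVneq c.1.1 s.
    rewrite E update_letter permM -E pc.
    by move: z1 x1; rewrite E eqxx /= => z1 x1; rewrite tpermD // eq_sym.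
  have [E|nls] := eqVneq c.1.1 (linv s).
    rewrite E letter_perm_linv update_letter invMg permM tpermV.
    move: z2 x2; rewrite E eqxx /= => z2 x2; rewrite tpermD 1?eq_sym //.
    by rewrite -letter_perm_linv -E pc.
  by rewrite update_other // pc.
apply: leq_trans (leq_mul (leqnn _) Zn) _; rewrite mulnC -sum_nat_const.
apply: (@leq_trans (\sum_(x in Z) #|extensions ((s, y, x) :: C)|)).
  exact: leq_sum.
rewrite -(@card_in_imset _ _ id) // -[X in _ <= X]sum1_card.
rewrite (partition_big (fun p : perms => letter_perm p s y) xpredT) //=.
apply: (@leq_trans (\sum_x #|extensions ((s, y, x) :: C)|)).
  by rewrite [X in _ <= X](bigID (mem Z)) /= leq_addr.
apply: leq_sum => x _; rewrite -sum1_card; apply: eq_leq; apply: eq_bigl => p.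
by rewrite imset_id !inE /= andbC.
Qed.

Definition realize (x0 : 'I_n) (X : seq 'I_n) (c : edge_of nat) : edge_of 'I_n :=
  (c.1.1, nth x0 X c.1.2, nth x0 X c.2).

(** The constraints are revealed one at a time; [uniq X] transfers freeness from vertex numbers to
    vertices. *)
Lemma card_extensions_realize x0 (X : seq 'I_n) (C : seq (edge_of nat)) m :
  uniq X -> all (fun c : edge_of nat => (c.1.2 < size X) && (c.2 < size X)) C ->
  pairwise (@free_from _) C -> size C <= m ->
  #|extensions (map (realize x0 X) C)| * (n - m) ^ size C <= #|{: perms}|.
Proof.
move=> uX; elim/last_ind: C => [|C c IH].
  by move=> _ _ _; rewrite expn0 muln1 max_card.
rewrite all_rcons pairwise_rcons size_rcons => /andP[/andP[c1 c2] Cs] /andP[cC fC] Cm.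
apply: leq_trans (IH Cs fC (ltnW Cm)).
rewrite expnS mulnA leq_mul2r; apply/orP; right.
set C' := map _ C.
have -> : extensions (map (realize x0 X) (rcons C c)) =
          extensions (realize x0 X c :: C').
  by apply/setP => p; rewrite !inE map_rcons all_rcons.
apply: (@leq_trans (#|extensions (realize x0 X c :: C')| * (n - size C'))).
  by rewrite leq_mul2l leq_sub2l ?orbT // size_map ltnW.
apply: card_extensions_cons; rewrite all_map; apply/allP => c' c'C /=.
have /andP[c'1 c'2] := allP Cs _ c'C.
have := allP cC _ c'C; rewrite /free_from /realize /=.
by rewrite !nth_uniq.
Qed.

(** Occurrences of the abstract graph [C] on the vertices [0, ..., v - 1] in the graph of the
    permutations, with vertex [0] placed at the start of the walk. *)
Definition realizations (x0 : 'I_n) (v : nat) (C : seq (edge_of nat)) :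
    {set perms * 'I_n} :=
  [set px | [exists X : v.-tuple 'I_n, [&& uniq X, nth x0 X 0 == px.2 &
     px.1 \in extensions (map (realize x0 X) C)]]].

(** Union bound over at most [n ^ v] placements. The expected number of occurrences is of order at
    most [n ^ (v - size C)], so an edge in excess of the vertices gains a factor [1 / n]. *)
Lemma card_realizations x0 v (C : seq (edge_of nat)) m :
  all (fun c : edge_of nat => (c.1.2 < v) && (c.2 < v)) C ->
  pairwise (@free_from _) C -> size C <= m ->
  #|realizations x0 v C| * (n - m) ^ size C <= n ^ v * #|{: perms}|.
Proof.
move=> Cv fC Cm.
pose F (X : v.-tuple 'I_n) : {set perms * 'I_n} :=
  if uniq X then
    [set (p, nth x0 X 0) | p in extensions (map (realize x0 X) C)]
  else finset.set0.
rewrite -[X in X ^ v]card_ord -card_tuple; apply: (@union_bound _ _ _ F).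
  move=> [p x]; rewrite inE => /existsP[X /and3P[uX /eqP /= <- pX]].
  by exists X; rewrite /F uX; apply: imset_f.
move=> X; rewrite /F; case: ifP => uX; last by rewrite cards0.
rewrite card_imset; last by move=> p p' [].
by apply: card_extensions_realize; rewrite ?size_tuple.
Qed.

End Extensions.

(** * Closed walks of primitive words *)

Section ClosedWalks.
Variables (d n : nat).
Local Notation letter := (letter d).
Local Notation perms := {ffun 'I_d -> 'S_n}.
Variables (s0 : letter) (x0 : 'I_n).
Implicit Types (b : seq letter) (p : perms) (x : 'I_n).

Definition position p b x t := walk p (take t b) x.

Lemma position_step p b x t : t < size b ->
  letter_perm p (nth s0 b t) (position p b x t) = position p b x t.+1.
Proof.
by move=> tb; rewrite /position (take_nth s0 tb) -cats1 walk_cat.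
Qed.

(* The edges crossed at the given times by a walk spelling [b], whose vertex
   at time [t] carries the number [g t]. *)
Definition walk_edges b (g : nat -> nat) (times : seq nat) :
    seq (edge_of d nat) :=
  [seq (nth s0 b t, g t, g t.+1) | t <- times].

Lemma realizations_walk p b x g times v (X : seq 'I_n) :
  size X = v -> uniq X -> nth x0 X 0 = x ->
  (forall t, t \in times ->
     [/\ t < size b, position p b x t = nth x0 X (g t) &
         position p b x t.+1 = nth x0 X (g t.+1)]) ->
  (p, x) \in realizations x0 v (walk_edges b g times).
Proof.
move=> /eqP sX uX X0 tP; rewrite inE; apply/existsP; exists (Tuple sX).
rewrite /= uX X0 eqxx /= inE /walk_edges -map_comp all_map.
apply/allP => t /tP [tb E E'] /=.
by rewrite -E -E' position_step.
Qed.

Lemma pairwise_walk_edges b g times :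
  pairwise ltn times ->
  (forall t' t, t' \in times -> t \in times -> t' < t ->
     (nth s0 b t' = nth s0 b t -> g t' <> g t) /\
     (nth s0 b t' = linv (nth s0 b t) -> g t'.+1 <> g t)) ->
  pairwise (@free_from _ _) (walk_edges b g times).
Proof.
move=> srt H; rewrite /walk_edges pairwise_map.
have := srt; apply: (@sub_in_pairwise _ [in times]); last exact/allP.
move=> t' t t'T tT lt; have [H1 H2] := H t' t t'T tT lt.
rewrite /free_from /=; apply/andP; split.
  by case: eqP => //= E; apply/eqP/H1.
by case: eqP => //= E; apply/eqP/H2.
Qed.

Lemma nonbacktracking_nth b t : sorted (@nonbacktracking d) b -> t.+1 < size b ->
  nth s0 b t <> linv (nth s0 b t.+1).
Proof.
move=> /(sortedP s0) srt tb E; have := srt t tb.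
by rewrite /nonbacktracking E linvK eqxx.
Qed.

(** The walk traces a cycle with as many edges as vertices, which contributes the main term [1] to
    the expected number of fixed points. *)
Lemma card_simple_closed b : sorted (@nonbacktracking d) b -> 0 < size b ->
  #|[set px : perms * 'I_n | uniq (mkseq (position px.1 b px.2) (size b)) &
       walk px.1 b px.2 == px.2]| * (n - size b) ^ size b
  <= n ^ size b * #|{: perms}|.
Proof.
set m := size b => srt m0.
pose C := walk_edges b (modn^~ m) (iota 0 m).
have sC : size C = m by rewrite size_map size_iota.
have CR : #|realizations x0 m C| * (n - m) ^ size C <= n ^ m * #|{: perms}|.
  apply: card_realizations; last by rewrite sC.
    by apply/allP => _ /mapP[t _ ->] /=; rewrite !ltn_mod m0.
  apply: pairwise_walk_edges.
    by rewrite -sorted_pairwise ?iota_ltn_sorted //; exact: ltn_trans.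
  move=> t' t; rewrite !mem_iota !add0n => /= t'm tm lt; split.
    by rewrite !modn_small //; lia.
  rewrite !modn_small //; [|lia] => E E'; subst t.
  exact: nonbacktracking_nth E.
rewrite sC in CR; apply: leq_trans CR; rewrite leq_mul2r; apply/orP; right.
apply/subset_leq_card/fintype.subsetP => -[p x].
rewrite inE /= => /andP[uX /eqP cl].
apply: (realizations_walk (X := mkseq (position p b x) m)) => //.
- by rewrite size_mkseq.
- by rewrite nth_mkseq // /position take0.
move=> t; rewrite mem_iota add0n => /= tm; split=> //.
  by rewrite modn_small // nth_mkseq.
have [t1m|] := ltnP t.+1 m; first by rewrite modn_small // nth_mkseq.
move=> mt; have -> : t.+1 = m by lia.
by rewrite modnn nth_mkseq // /position take0 take_size.
Qed.

(** A walk back at its start at time [i] keeps going around the same cycle as long as its letters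
    repeat with period [i]. *)
Lemma position_periodic p b x i q : i <= q <= size b ->
  (forall t, i <= t < q -> nth s0 b t = nth s0 b (t - i)) ->
  0 < i -> position p b x i = x ->
  forall t, t <= q -> position p b x t = position p b x (t %% i).
Proof.
move=> /andP[iq qb] per i0 xi.
have shift t : i <= t <= q -> position p b x t = position p b x (t - i).
  elim: t => [|t IH] /andP[it tq]; first by lia.
  have [iE|it'] := eqVneq i t.+1; first by rewrite -iE subnn xi /position take0.
  rewrite -position_step; last by lia.
  rewrite per; last by lia.
  rewrite IH; last by lia.
  by rewrite subSn ?position_step //; lia.
move=> t; have [k] := ubnP t; elim: k t => // k IH t tk tq.
have [ti|it] := ltnP t i; first by rewrite modn_small.
rewrite shift ?it // IH; [|lia|lia].
by rewrite -[in RHS](subnK it) modnDr.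
Qed.

(** Closed walks whose first repetition is a return to the start at time [i]. *)
Definition looping b i :=
  [set px : perms * 'I_n | [&& uniq (mkseq (position px.1 b px.2) i),
     position px.1 b px.2 i == px.2 & walk px.1 b px.2 == px.2]].

(** * Walks that leave a first cycle and hit a known vertex again *)

Section Lasso.
Variables (b : seq letter) (i q : nat).
Hypotheses (srt : sorted (@nonbacktracking d) b) (i0 : 0 < i) (iq : i <= q)
  (qm : q < size b).
Hypothesis per : forall t, i <= t < q -> nth s0 b t = nth s0 b (t - i).
Hypothesis dev : nth s0 b q <> nth s0 b (q - i).

(* Vertex numbering of a walk that goes around a cycle of length [i] until time
   [q], then visits [r] new vertices and finally hits the known vertex [tgt]. *)
Definition lasso_index r tgt t :=
  if t <= q then t %% i else if t <= q + r then i + (t - q.+1) else tgt.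

(** Times [i] to [q - 1] only repeat edges of the cycle and are omitted. This leaves [i + r + 1]
    edges on [i + r] vertices. *)
Definition lasso r tgt :=
  walk_edges b (lasso_index r tgt) (iota 0 i ++ iota q r.+1).

Lemma lasso_pairwise r tgt : q + r < size b ->
  pairwise (@free_from _ _) (lasso r tgt).
Proof.
move=> qr; have per_mod t : t < q -> nth s0 b t = nth s0 b (t %% i).
  move=> tq; have tiq : t %% i < q by rewrite (leq_ltn_trans (leq_mod _ _)).
  rewrite -(nth_take s0 tq b) -(nth_take s0 tiq b); apply: periodic_nth => //.
    move=> u; rewrite size_takel ?(ltnW qm) // => /andP[iu uq].
    have uiq : u - i < q by lia.
    by rewrite !nth_take // per // iu.
  by rewrite size_takel // ltnW.
apply: pairwise_walk_edges.
  rewrite pairwise_cat; apply/and3P; split.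
  - by apply/allrelP => t u; rewrite !mem_iota; lia.
  - by rewrite -sorted_pairwise ?iota_ltn_sorted //; exact: ltn_trans.
  - by rewrite -sorted_pairwise ?iota_ltn_sorted //; exact: ltn_trans.
have small t : t < i -> lasso_index r tgt t = t.
  by move=> ti; rewrite /lasso_index modn_small // (_ : t <= q) //; lia.
have cyc t : t <= q -> lasso_index r tgt t < i.
  by move=> tq; rewrite /lasso_index tq ltn_mod.
have path t : q < t -> t <= q + r -> lasso_index r tgt t = i + (t - q.+1).
  by move=> qt tqr; rewrite /lasso_index tqr (_ : t <= q = false) //; lia.
move=> t' t; rewrite !mem_cat !mem_iota !add0n => t'T tT lt.
(* After time [q] each edge starts at a new vertex, entered only by the preceding edge, whose letter
   is not inverse to its own. *)
have [qt|tq] := ltnP q t.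
  rewrite [lasso_index r tgt t]path //; [|lia].
  have [qt'|t'q] := ltnP q t'.
    split; first by rewrite path //; lia.
    move=> E; rewrite path; [|lia|lia] => E'; have tE : t = t'.+1 by lia.
    by apply: (nonbacktracking_nth (t := t') srt); rewrite -tE //; lia.
  split; first by have := cyc t' t'q; lia.
  move=> E; have [t'E|nt'] := eqVneq t' q.
    rewrite t'E path; [|lia|lia] => E'; have tE : t = t'.+1 by lia.
    by apply: (nonbacktracking_nth (t := t') srt); rewrite -tE //; lia.
  by have := cyc t'.+1; lia.
have [ti|it] := ltnP t i.
  rewrite (small t) // (small t'); [|lia].
  split; first by lia.
  move=> E; rewrite (small t'.+1); [|lia] => tE.
  by apply: (nonbacktracking_nth (t := t') srt); rewrite tE //; lia.
(* The edge leaving the cycle: [dev] separates it from the cycle edge with the same source,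
   nonbacktracking from the cycle edge ending there. *)
have tE : t = q by lia.
have t'i : t' < i by lia.
subst t; rewrite small //; rewrite {1 2}/lasso_index leqnn; split.
  move=> E t'E; apply: dev; rewrite -E t'E.
  rewrite [RHS]per_mod; last by lia.
  by rewrite -{1}(subnK iq) modnDr.
move=> E; rewrite /lasso_index (_ : t'.+1 <= q) 1?(leq_trans t'i) // => mE.
apply: (nonbacktracking_nth (t := q.-1) srt); rewrite prednK //; try lia.
rewrite -E per_mod; [|lia]; congr nth.
have : t' = q.-1 %[mod i].
  by apply/eqP; rewrite -(eqn_modDr 1) !addn1 prednK ?mE ?leqnn //; lia.
by rewrite (modn_small t'i).
Qed.

(** The excess edge saves a factor [n]. Padding by powers of [n - size b <= n] makes the bound
    uniform in [r]. *)
Lemma card_lasso r tgt : q + r < size b -> tgt < i + r ->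
  #|realizations x0 (i + r) (lasso r tgt)| * (n - size b) ^ size b
  <= n ^ (size b).-1 * #|{: perms}|.
Proof.
move=> qr tr.
have sC : size (lasso r tgt) = (i + r).+1.
  by rewrite size_map size_cat !size_iota addnS.
have sCm : size (lasso r tgt) <= size b by rewrite sC; lia.
rewrite -[X in (_ - _) ^ X](subnKC sCm) expnD mulnA.
have -> : n ^ (size b).-1 = n ^ (i + r) * n ^ (size b - size (lasso r tgt)).
  by rewrite -expnD; congr expn; lia.
rewrite [X in _ <= X]mulnAC; apply: leq_mul; last by case: (size b - _) => // e; rewrite leq_exp2r ?leq_subr.
apply: card_realizations => //; last exact: lasso_pairwise.
apply/allP => _ /mapP[t tT ->] /=.
have lt u : u <= q + r.+1 -> lasso_index r tgt u < i + r.
  rewrite /lasso_index => uqr; case: ifP => uq.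
    by rewrite (leq_trans (_ : _ < i)) ?leq_addr // ltn_mod.
  by case: ifP => uqr' //; lia.
by move: tT; rewrite mem_cat !mem_iota !add0n => tT; rewrite !lt //; lia.
Qed.

Lemma looping_lasso p x : (p, x) \in looping b i ->
  exists r tgt, [/\ q + r < size b, tgt < i + r &
    (p, x) \in realizations x0 (i + r) (lasso r tgt)].
Proof.
rewrite inE /= => /and3P[uX /eqP xi /eqP cl].
set pos := position p b x in uX xi.
pose X r := mkseq pos i ++ mkseq (fun l => pos (q + l.+1)) r.
have sX r : size (X r) = i + r by rewrite size_cat !size_mkseq.
have pos0 : pos 0 = x by rewrite /pos /position take0.
(* The walk ends at its start, so it meets a known vertex after time [q]; the least such [r] makes
   all vertices before the hit distinct. *)
have hit : exists r, pos (q + r.+1) \in X r.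
  exists (size b - q.+1); rewrite (_ : q + _ = size b); last by lia.
  rewrite mem_cat {1}/pos /position take_size cl -pos0.
  by rewrite map_f // mem_iota.
pose r := ex_minn hit.
have [rX rmin] : pos (q + r.+1) \in X r /\ forall r', pos (q + r'.+1) \in X r' -> r <= r'.
  by rewrite /r; case: ex_minnP.
have qr : q + r < size b.
  suff : r <= size b - q.+1 by lia.
  apply: rmin; rewrite (_ : q + _ = size b); last by lia.
  rewrite mem_cat {1}/pos /position take_size cl -pos0.
  by rewrite map_f // mem_iota.
have uXr : uniq (X r).
  suff : forall r', r' <= r -> uniq (X r') by apply.
  elim=> [|r' IH] r'r; first by rewrite /X cats0.
  rewrite /X mkseqS -rcons_cat rcons_uniq IH 1?ltnW // andbT.
  by apply: contraL r'r => /rmin; rewrite leqNgt.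
exists r, (index (pos (q + r.+1)) (X r)); split=> //.
  by rewrite -sX index_mem.
have Xcyc t : t <= q -> pos t = nth x0 (X r) (t %% i).
  move=> tq; rewrite nth_cat size_mkseq ltn_mod i0 nth_mkseq ?ltn_mod //.
  by apply: (position_periodic (q := q)) => //; lia.
have Xpos t : t <= q + r.+1 ->
    pos t = nth x0 (X r) (lasso_index r (index (pos (q + r.+1)) (X r)) t).
  move=> tqr; rewrite /lasso_index; case: ifP => [/Xcyc //|tq].
  case: ifP => tqr'; last by rewrite nth_index //; congr pos; lia.
  rewrite nth_cat size_mkseq ltnNge leq_addr /= addKn nth_mkseq; last by lia.
  by congr pos; lia.
apply: (realizations_walk (X := X r)) => //.
  by rewrite -[RHS]pos0 Xcyc // mod0n.
move=> t; rewrite mem_cat !mem_iota !add0n => tT.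
by split; [lia|apply: Xpos; lia|apply: Xpos; lia].
Qed.

End Lasso.

Lemma card_looping b i : sorted (@nonbacktracking d) b -> primitive_word b ->
  0 < i < size b ->
  #|looping b i| * (n - size b) ^ size b
  <= size b ^ 2 * (n ^ (size b).-1 * #|{: perms}|).
Proof.
set m := size b => srt prim /andP[i0 im].
have [/ex_minnP[q /and3P[iq qm /eqP dev] qmin]|nodev] := pselect (exists q,
    [&& i <= q, q < m & nth s0 b q != nth s0 b (q - i)]); last first.
  (* With period [i] up to the end, closing the walk forces [i] to divide the length, so [b] would
     be a proper power. *)
  suff -> : looping b i = finset.set0 by rewrite cards0.
  have per t : i <= t < m -> nth s0 b t = nth s0 b (t - i).
    move=> /andP[it tm]; apply/eqP/negP => /negP ne.
    by apply: nodev; exists t; rewrite it tm.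
  apply/setP => -[p x]; rewrite !inE /=.
  apply/negP => /and3P[uX /eqP xi /eqP cl].
  have mm : i <= m <= size b by rewrite (ltnW im) leqnn.
  have := position_periodic mm per i0 xi (leqnn m).
  rewrite {1}/position take_size cl => E.
  have mi : m %% i < i by rewrite ltn_mod.
  have m_mod : m %% i = 0.
    move/mkseq_uniqP: uX; apply; rewrite ?inE //.
    by rewrite -E /position take0.
  have idvd : i %| size b by rewrite /dvdn m_mod.
  have iP : 0 < i < size b by rewrite i0.
  by have /negP := prim i iP idvd; apply; apply/(rot_periodic s0 iP idvd).
have per t : i <= t < q -> nth s0 b t = nth s0 b (t - i).
  move=> /andP[it tq]; apply/eqP/negP => /negP ne.
  by have := qmin t; rewrite it ne (ltn_trans tq qm) => /(_ isT); lia.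
pose F (rt : 'I_m * 'I_m) : {set perms * 'I_n} :=
  if (q + rt.1 < m) && (rt.2 < i + rt.1)
  then realizations x0 (i + rt.1) (lasso b i q rt.1 rt.2) else finset.set0.
have -> : m ^ 2 = #|{: 'I_m * 'I_m}| by rewrite card_prod card_ord mulnn.
apply: (@union_bound _ _ _ F) => [[p x]|[r tgt]].
  move=> /(looping_lasso srt i0 iq qm per) [r [tgt [qr tr H]]].
  have rm : r < m by lia.
  have tm : tgt < m by lia.
  by exists (Ordinal rm, Ordinal tm); rewrite /F /= qr tr.
rewrite /F /=; case: ifP => [/andP[qr tr]|_]; last by rewrite cards0.
exact: card_lasso.
Qed.

Lemma cycle_sorted b : path.cycle (@nonbacktracking d) b ->
  sorted (@nonbacktracking d) b.
Proof. by case: b => //= s b; rewrite rcons_path => /andP[]. Qed.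

Lemma primitive_rot b a : primitive_word b -> primitive_word (rot a b).
Proof.
move=> prim i; rewrite size_rot => iP idvd; rewrite rot_rot.
by rewrite (inj_eq (rot_inj (n0 := a))); apply: prim.
Qed.

Lemma position_rot p b x a j : a + j <= size b ->
  position p (rot a b) (position p b x a) j = position p b x (a + j).
Proof.
move=> ajb; rewrite /position takeD walk_cat; congr walk.
by rewrite /rot takel_cat // size_drop; lia.
Qed.

(** Let [c] be the first time of a repeated vertex and [a] its earlier visit: the walk started at
    time [a] first closes a cycle of length [c - a]. *)
Lemma nonuniq_looping p b x : walk p b x = x ->
  ~~ uniq (mkseq (position p b x) (size b)) ->
  exists a i, [/\ a < size b, 0 < i < size b &
    (p, position p b x a) \in looping (rot a b) i].
Proof.
set pos := position p b x => cl nu.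
have rep : exists c, (c < size b) && (pos c \in mkseq pos c).
  have [//|none] := pselect (exists c, (c < size b) && (pos c \in mkseq pos c)).
  case/negP: nu; suff: forall m, m <= size b -> uniq (mkseq pos m) by apply.
  elim=> // m IH mb; rewrite mkseqS rcons_uniq IH 1?ltnW // andbT.
  by apply/negP => pm; apply: none; exists m; rewrite mb.
case: (ex_minnP rep) => c /andP[cb pc] cmin.
have uc : uniq (mkseq pos c).
  suff: forall m, m <= c -> uniq (mkseq pos m) by apply.
  elim=> // m IH mc; rewrite mkseqS rcons_uniq IH 1?ltnW // andbT.
  apply/negP => pm; have := cmin m; rewrite pm (ltn_trans mc cb) => /(_ isT).
  by rewrite leqNgt mc.
have /mapP[a] := pc; rewrite mem_iota add0n => /= ac pca.
exists a, (c - a); split; [lia|lia|rewrite inE /=; apply/and3P; split].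
- apply/mkseq_uniqP => j j'; rewrite !inE => jc j'c.
  rewrite !position_rot; [|lia|lia] => /(mkseq_uniqP _ _ uc).
  by rewrite !inE => H; apply/eqP; rewrite -(eqn_add2l a); apply/eqP/H; lia.
- by rewrite position_rot ?subnKC -/pos ?pca //; lia.
- rewrite /rot walk_cat /pos /position -(walk_cat p (take a b)).
  by rewrite cat_take_drop cl.
Qed.

(** The factor [size b ^ 4] comes from the choice of a rotation and a cycle length, then of the two
    parameters of a lasso. *)
Lemma card_closed_walks b : path.cycle (@nonbacktracking d) b ->
  0 < size b -> primitive_word b ->
  (\sum_(p : perms) #|fixpoints p b|) * (n - size b) ^ size b
  <= (n ^ size b + size b ^ 4 * n ^ (size b).-1) * #|{: perms}|.
Proof.
set m := size b => cyc m0 prim.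
pose A := [set px : perms * 'I_n |
  uniq (mkseq (position px.1 b px.2) m) & walk px.1 b px.2 == px.2].
pose B := [set px : perms * 'I_n |
  ~~ uniq (mkseq (position px.1 b px.2) m) & walk px.1 b px.2 == px.2].
have -> : \sum_(p : perms) #|fixpoints p b| = #|A| + #|B|.
  rewrite -cardsUI; have -> : A :&: B = finset.set0.
    by apply/setP => px; rewrite !inE; case: uniq; rewrite ?andbF.
  rewrite cards0 addn0 -[RHS]sum1_card [RHS]big_mkcond /=.
  transitivity (\sum_p \sum_x if (p, x) \in A :|: B then 1 else 0); last first.
    by rewrite pair_bigA; apply: eq_bigr => -[].
  apply: eq_bigr => p _; rewrite -sum1_card [LHS]big_mkcond; apply: eq_bigr => x _.
  by rewrite !inE /=; case: uniq; rewrite ?orbF.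
rewrite !mulnDl leq_add ?card_simple_closed ?cycle_sorted //.
pose F (ai : 'I_m * 'I_m) : {set perms * 'I_n} :=
  if 0 < ai.2 then
    [set px | (px.1, position px.1 b px.2 ai.1) \in looping (rot ai.1 b) ai.2]
  else finset.set0.
have -> : m ^ 4 = #|{: 'I_m * 'I_m}| * m ^ 2.
  by rewrite card_prod card_ord mulnn -expnD.
rewrite -2!mulnA.
apply: (@union_bound _ _ _ F) => [[p x]|[a i]].
  rewrite inE => /andP[nu /eqP cl].
  have [a [i [am /andP[i0 im] H]]] := nonuniq_looping cl nu.
  by exists (Ordinal am, Ordinal im); rewrite /F /= i0 inE.
rewrite /F /=; case: ifP => i0; last by rewrite cards0.
apply: (@leq_trans (#|looping (rot a b) i| * (n - m) ^ m)).
  rewrite leq_mul2r; apply/orP; right.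
  (* Moving the start along the walk is injective for fixed permutations. *)
  pose h (px : perms * 'I_n) := (px.1, position px.1 b px.2 a).
  have hinj : injective h by move=> [p x] [p' x'] [<- /walk_inj ->].
  rewrite -[X in X <= _](card_imset _ hinj).
  apply/subset_leq_card/fintype.subsetP.
  by move=> y /imsetP[px pxF ->]; rewrite inE in pxF.
have srt : sorted (@nonbacktracking d) (rot a b).
  by apply: cycle_sorted; rewrite rot_cycle.
have := @card_looping (rot a b) i srt (primitive_rot prim).
by rewrite size_rot -/m i0 ltn_ord; apply.
Qed.

End ClosedWalks.

(** * The trace bound *)

Local Open Scope ring_scope.

Section Frobenius.
Variable R : realType.

Lemma sum_tuple_cons (T : finType) k (G : k.+1.-tuple T -> R) :
  \sum_(w : k.+1.-tuple T) G w = \sum_s \sum_(w : k.-tuple T) G [tuple of s :: w].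
Proof.
rewrite pair_bigA /= (reindex (fun sw : T * k.-tuple T => [tuple of sw.1 :: sw.2])) //=.
exists (fun w => (thead w, [tuple of behead w])) => [[s w] _|w _] /=.
  by congr pair; apply: val_inj.
by rewrite [RHS]tuple_eta.
Qed.

(** Lagrange's identity: twice the difference of the two sides is a sum of squares. *)
Lemma cauchy_schwarz (I : finType) (a b : I -> R) :
  (\sum_i a i * b i) ^+ 2 <= (\sum_i a i ^+ 2) * (\sum_i b i ^+ 2).
Proof.
rewrite -subr_ge0.
have : 0 <= \sum_i \sum_j (a i * b j - a j * b i) ^+ 2.
  by apply: sumr_ge0 => i _; apply: sumr_ge0 => j _; exact: sqr_ge0.
suff -> : \sum_i \sum_j (a i * b j - a j * b i) ^+ 2 =
  ((\sum_i a i ^+ 2) * (\sum_i b i ^+ 2) - (\sum_i a i * b i) ^+ 2) *+ 2.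
  by rewrite pmulrn_lge0.
rewrite expr2 !big_distrlr /=.
transitivity (\sum_i \sum_j (a i ^+ 2 * b j ^+ 2 + a j ^+ 2 * b i ^+ 2
     - (a i * b i * (a j * b j)) *+ 2)).
  by apply: eq_bigr => i _; apply: eq_bigr => j _; ring.
under [LHS]eq_bigr => i _ do rewrite sumrB big_split /= sumrMnl.
rewrite sumrB big_split /= sumrMnl mulrnBl; congr (_ - _).
by rewrite [X in _ + X = _]exchange_big mulr2n.
Qed.

Lemma mul_permutation_mx (T : finType) (t : {perm T}) m
    (f : 'M[R]_(#|T|, m)) x j :
  (permutation_mx R t *m f) x j = f (enum_rank (t (enum_val x))) j.
Proof.
rewrite mxE (bigD1 (enum_rank (t (enum_val x)))) //= mxE enum_rankK eqxx mul1r.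
rewrite big1 ?addr0 // => y ny; rewrite mxE.
case: eqP => [E|_]; last by rewrite mul0r.
by case/eqP: ny; rewrite E enum_valK.
Qed.

Lemma invmx_permutation_mx (T : finType) (t : {perm T}) :
  invmx (permutation_mx R t) = permutation_mx R t^-1%g.
Proof.
have E : permutation_mx R t *m permutation_mx R t^-1%g = 1%:M.
  apply/matrixP => x y; rewrite mul_permutation_mx !mxE enum_rankK permK.
  by rewrite (inj_eq enum_val_inj).
have [tu _] := mulmx1_unit E.
by rewrite -[RHS](mulKmx tu) E mulmx1.
Qed.

Lemma adjacency_mxE (T : finType) d (tau : 'I_d -> {perm T}) (f : 'cV[R]_#|T|) x :
  (adjacency_mx R tau *m f) (enum_rank x) 0 =
  \sum_(s : letter d) f (enum_rank (letter_perm tau s x)) 0.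
Proof.
rewrite /adjacency_mx mulmx_suml summxE.
rewrite -(pair_bigA _ (fun i c => f (enum_rank (letter_perm tau (i, c) x)) 0)) /=.
apply: eq_bigr => i _; rewrite big_bool /= mulmxDl mxE invmx_permutation_mx.
by rewrite !mul_permutation_mx enum_rankK.
Qed.

Lemma eigenfunction_walk (T : finType) d (tau : 'I_d -> {perm T}) (F : T -> R) a k :
  (forall x, \sum_(s : letter d) F (letter_perm tau s x) = a * F x) ->
  forall x, \sum_(w : k.-tuple (letter d)) F (walk tau w x) = a ^+ k * F x.
Proof.
move=> eig; elim: k => [|k IH] x.
  rewrite (bigD1 [tuple]) //= big1 ?addr0 ?mul1r // => w /eqP[].
  by rewrite tuple0.
rewrite sum_tuple_cons exprSr -mulrA -eig mulr_sumr; apply: eq_bigr => s _.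
by rewrite -IH.
Qed.

Lemma letter_perm_lift (V : finType) d n (sigma : 'I_d -> {perm V})
    (p : {ffun 'I_d -> 'S_n}) s x :
  letter_perm (lift_perms sigma p) s x =
  (letter_perm sigma s x.1, letter_perm p s x.2).
Proof.
rewrite /letter_perm /lift_perms; case: s.2; first by rewrite permE.
apply: (@perm_inj _ (pair_perm (sigma s.1) (p s.1))); rewrite permKV permE.
by rewrite /pair_map /= !permKV; case: x.
Qed.

Lemma walk_lift (V : finType) d n (sigma : 'I_d -> {perm V})
    (p : {ffun 'I_d -> 'S_n}) w x :
  walk (lift_perms sigma p) w x = (walk sigma w x.1, walk p w x.2).
Proof.
elim: w x => [|s w IH] x /=; first by case: x.
by rewrite letter_perm_lift IH.
Qed.

(** Test against the indicator of the fiber over [v]. *)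
Lemma new_function_fiber (V U : finType) (f : 'cV[R]_#|{: V * U}|) v :
  new_function f -> \sum_u f (enum_rank (v, u)) 0 = 0.
Proof.
move=> nf; pose g : 'cV[R]_#|{: V * U}| := \col_x ((enum_val x).1 == v)%:R.
have gP : fiber_constant g by move=> x y E; rewrite !mxE E.
rewrite -[RHS](nf g gP) [RHS](reindex (@enum_rank {: V * U})) /=; last first.
  by apply: onW_bij; exact: enum_rank_bij.
under [RHS]eq_bigr => x _ do rewrite mxE enum_rankK.
rewrite [RHS](eq_bigr (fun x => f (enum_rank (x.1, x.2)) 0 * (x.1 == v)%:R)); last by case.
rewrite -(pair_bigA _ (fun v' u => f (enum_rank (v', u)) 0 * (v' == v)%:R)) /=.
rewrite [RHS](bigD1 v) //= [X in _ = _ + X]big1.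
  by rewrite addr0; apply: eq_bigr => u _; rewrite eqxx mulr1.
by move=> v' /negbTE nv; rewrite big1 // => u _; rewrite nv mulr0.
Qed.

(* The squared Frobenius norm of the [k]-th power of the adjacency matrix
   composed with the orthogonal projection onto the new functions. *)
Definition new_trace (V : finType) d n (sigma : 'I_d -> {perm V})
    (p : {ffun 'I_d -> 'S_n}) k : R :=
  \sum_(w : k.-tuple (letter d)) \sum_(w' : k.-tuple (letter d))
    #|[set v | walk sigma w v == walk sigma w' v]%SET|%:R *
    (#|fixpoints p (w ++ winv w')|%:R - 1).

(** * Kernels of words on the new functions and the trace inequality *)

Section Kernel.
Variables (V : finType) (d n : nat) (sigma : 'I_d -> {perm V}).
Variables (p : {ffun 'I_d -> 'S_n}) (k : nat).
Hypothesis n_gt0 : (0 < n)%N.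

(** The permutation matrix of a lifted word composed with the projection onto new functions;
    [n%:R^-1] subtracts the fiber averages. *)
Definition kernel (w : seq (letter d)) (x y : V * 'I_n) : R :=
  (walk sigma w x.1 == y.1)%:R * ((walk p w x.2 == y.2)%:R - n%:R^-1).

Lemma sum_delta (T : finType) (z : T) (G : T -> R) : \sum_y (z == y)%:R * G y = G z.
Proof.
rewrite (bigD1 z) //= eqxx mul1r big1 ?addr0 // => y.
by rewrite eq_sym => /negbTE ->; rewrite mul0r.
Qed.

Lemma kernelE (w : seq (letter d)) (F : V * 'I_n -> R) x :
  (forall v, \sum_u F (v, u) = 0) ->
  \sum_y kernel w x y * F y = F (walk (lift_perms sigma p) w x).
Proof.
move=> F0; rewrite walk_lift.
rewrite (eq_bigr (fun y => kernel w x (y.1, y.2) * F (y.1, y.2))); last by case.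
rewrite -(pair_bigA _ (fun v u => kernel w x (v, u) * F (v, u))) /=.
under eq_bigr => v _ do (under eq_bigr => u _ do rewrite /kernel /= -mulrA;
  rewrite -mulr_sumr).
rewrite sum_delta; under eq_bigr => u _ do rewrite mulrBl.
by rewrite sumrB sum_delta -mulr_sumr F0 mulr0 subr0.
Qed.

(** Over a vertex where the base walks agree, the rows of two centred indicators have inner product
    [1 - 1 / n] or [- 1 / n]; summing over the fiber gives the number of fixed points minus [1]. *)
Lemma sum_kernelM (w w' : seq (letter d)) :
  \sum_x \sum_y kernel w x y * kernel w' x y =
  #|[set v | walk sigma w v == walk sigma w' v]%SET|%:R *
    (#|fixpoints p (w ++ winv w')|%:R - 1).
Proof.
have nn : n%:R^-1 *+ n = 1 :> R.
  by rewrite -[LHS]mulr_natr mulVf // pnatr_eq0 -lt0n.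
rewrite -sum1_card natr_sum [X in X * _]big_mkcond /= mulr_suml.
rewrite [LHS](eq_bigr (fun x => \sum_y kernel w (x.1, x.2) y * kernel w' (x.1, x.2) y)); last by case.
rewrite -(pair_bigA _ (fun v u => \sum_y kernel w (v, u) y * kernel w' (v, u) y)) /=.
apply: eq_bigr => v _.
transitivity (\sum_(u : 'I_n) (walk sigma w v == walk sigma w' v)%:R *
  \sum_(u' : 'I_n) ((walk p w u == u')%:R - n%:R^-1) * ((walk p w' u == u')%:R - n%:R^-1) : R).
  apply: eq_bigr => u _.
  rewrite [LHS](eq_bigr (fun y => kernel w (v, u) (y.1, y.2) * kernel w' (v, u) (y.1, y.2))); last by case.
  rewrite -(pair_bigA _ (fun v' u' => kernel w (v, u) (v', u') * kernel w' (v, u) (v', u'))) /=.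
  under eq_bigr => v' _ do (under eq_bigr => u' _ do rewrite /kernel /= mulrACA -mulrA;
    rewrite -!mulr_sumr).
  by rewrite sum_delta eq_sym.
rewrite -mulr_sumr inE; case: eqP => _; last by rewrite !mul0r.
congr (_ * _).
transitivity (\sum_(u : 'I_n) ((u \in fixpoints p (w ++ winv w'))%:R - n%:R^-1) : R).
  apply: eq_bigr => u _; rewrite -walk_agree.
  under eq_bigr => u' _ do rewrite mulrBl.
  rewrite sumrB sum_delta -mulr_sumr sumrB.
  under [X in _ * (X - _)]eq_bigr => u' _ do rewrite -[_%:R]mulr1.
  rewrite sum_delta sumr_const card_ord nn subrr mulr0 subr0.
  by rewrite eq_sym.
rewrite sumrB sumr_const card_ord nn; congr (_ - _).
by rewrite -sum1_card natr_sum [RHS]big_mkcond /=; apply: eq_bigr => u _; case: (_ \in _).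
Qed.

Lemma new_traceE : new_trace sigma p k =
  \sum_x \sum_y (\sum_(w : k.-tuple (letter d)) kernel w x y) ^+ 2.
Proof.
under [RHS]eq_bigr => x _ do under eq_bigr => y _ do
  rewrite expr2 big_distrlr /=.
under [RHS]eq_bigr => x _ do rewrite exchange_big /=.
rewrite exchange_big /=; apply: eq_bigr => w _.
under [RHS]eq_bigr => x _ do rewrite exchange_big /=.
by rewrite exchange_big /=; apply: eq_bigr => w' _; rewrite sum_kernelM.
Qed.

Lemma new_trace_ge0 : 0 <= new_trace sigma p k.
Proof.
by rewrite new_traceE; apply: sumr_ge0 => x _; apply: sumr_ge0 => y _; exact: sqr_ge0.
Qed.

(** The spectral norm is at most the Frobenius norm: [a ^+ k * F x] pairs [F] with row [x] of the
    summed kernel, and Cauchy-Schwarz applies row by row. *)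
Lemma new_eigenvalue_le a : new_eigenvalues R sigma p a ->
  a ^+ (2 * k) <= new_trace sigma p k.
Proof.
move=> [f [f0 nf eig]].
pose F x := f (enum_rank x) 0.
have Feig x : \sum_(s : letter d) F (letter_perm (lift_perms sigma p) s x) = a * F x.
  by rewrite -adjacency_mxE eig mxE.
have Fk := eigenfunction_walk k Feig.
have Fpos : 0 < \sum_x F x ^+ 2.
  rewrite lt_def sumr_ge0 ?andbT => [|x _]; last exact: sqr_ge0.
  apply: contra f0 => /eqP /psumr_eq0P F0; apply/eqP/matrixP => i j.
  rewrite ord1 mxE -(enum_valK i); apply/eqP.
  by rewrite -sqrf_eq0; apply/eqP/F0 => // x _; exact: sqr_ge0.
rewrite -(ler_pM2r Fpos) mulr_sumr new_traceE mulr_suml.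
apply: ler_sum => x _; rewrite mulnC exprM -exprMn -Fk.
apply: le_trans (cauchy_schwarz _ _).
rewrite le_eqVlt; apply/orP; left; apply/eqP; congr (_ ^+ 2).
under [RHS]eq_bigr => y _ do rewrite mulr_suml.
rewrite exchange_big /=; apply: eq_bigr => w _.
by rewrite kernelE // => v; exact: new_function_fiber.
Qed.

End Kernel.
End Frobenius.

(** * Moments *)

Section Moments.
Variable R : realType.

Lemma bernoulli_le (x : R) m : -1 <= x -> 1 + m%:R * x <= (1 + x) ^+ m.
Proof.
move=> x1; elim: m => [|m IH]; first by rewrite expr0 mul0r addr0.
have x0 : 0 <= 1 + x by rewrite -lerBlDl sub0r.
rewrite exprS -natr1; apply: le_trans (ler_wpM2l x0 IH).
have m0 : 0 <= m%:R :> R by exact: ler0n.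
have : 0 <= m%:R * x ^+ 2 by rewrite mulr_ge0 // sqr_ge0.
by nra.
Qed.

(** With [j = k %/ 5], Bernoulli gives [q ^+ k >= (j * y) ^+ 5], and the fifth power of [j] absorbs
    both the quartic and the constant. *)
Lemma quartic_le_exp (q K : R) : 1 < q -> 0 <= K ->
  exists k0, forall k, (k0 <= k)%N -> K * ((2 * k).+1 ^ 4)%:R <= q ^+ k.
Proof.
move=> q1 K0; pose y := q - 1; have y0 : 0 < y by rewrite subr_gt0.
have y5 : 0 < y ^+ 5 by rewrite exprn_gt0.
have B0 : 0 <= K * 19 ^+ 4 / y ^+ 5.
  by apply: divr_ge0; [rewrite mulr_ge0 ?exprn_ge0 ?ler0n | exact: ltW].
exists (5 * (Num.bound (K * 19 ^+ 4 / y ^+ 5)).+1)%N => k kk.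
pose j := (k %/ 5)%N.
have jB : ((Num.bound (K * 19 ^+ 4 / y ^+ 5)).+1 <= j)%N by rewrite /j; lia.
(* As [j >= 1], [2 * k + 1 <= 10 * j + 9 <= 19 * j]. *)
have j19 : ((2 * k).+1 <= 19 * j)%N by rewrite /j; lia.
have jk : (j * 5 <= k)%N by rewrite /j; lia.
apply: (@le_trans _ _ (K * (19 * j%:R) ^+ 4)).
  rewrite ler_wpM2l // natrX lerXn2r ?nnegrE ?ler0n ?mulr_ge0 //.
  by rewrite -natrM ler_nat.
have jy : j%:R * y <= q ^+ j.
  have -> : q = 1 + y by rewrite /y addrC subrK.
  have y1 : -1 <= y by apply: le_trans (ltW y0); rewrite lerN10.
  by apply: le_trans (bernoulli_le j y1); rewrite lerDr.
apply: le_trans (ler_weXn2l (ltW q1) jk); rewrite exprM.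
apply: le_trans (_ : (j%:R * y) ^+ 5 <= _); last first.
  by rewrite lerXn2r ?nnegrE ?exprn_ge0 ?mulr_ge0 ?ler0n // ltW // (lt_trans ltr01).
rewrite exprMn mulrA [X in _ <= X]exprMn [j%:R ^+ 5]exprS mulrAC.
rewrite ler_wpM2r ?exprn_ge0 // -ler_pdivrMr //.
apply: le_trans (ltW (archi_boundP B0)) _.
by rewrite ler_nat ltnW.
Qed.

(** Jensen's inequality through the tangent of [x ^+ m] at [1], applied to [X w / t]. *)
Lemma mean_le_moment (T : finType) (X : T -> R) (t : R) m : (0 < m)%N -> 0 < t ->
  (forall w, 0 <= X w) -> \sum_w X w ^+ m <= #|T|%:R * t ^+ m ->
  \sum_w X w <= #|T|%:R * t.
Proof.
move=> m0 t0 X0 Xm.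
have mR : 0 < m%:R :> R by rewrite ltr0n.
have Xt w : m%:R * (X w / t) <= (X w / t) ^+ m + (m%:R - 1).
  have h : -1 <= X w / t - 1 by rewrite lerBrDr addNr divr_ge0 // ltW.
  have := bernoulli_le m h; rewrite [1 + (_ - 1)]addrC subrK => h'.
  by apply: le_trans (_ : _ <= (1 + m%:R * (X w / t - 1)) + (m%:R - 1)) _; [lra|lra].
have : \sum_w m%:R * (X w / t) <= \sum_w ((X w / t) ^+ m + (m%:R - 1)).
  by apply: ler_sum => w _; exact: Xt.
rewrite -mulr_sumr big_split /= sumr_const -mulr_suml.
under [X in _ <= X + _]eq_bigr => w _ do rewrite expr_div_n.
rewrite -mulr_suml => H.
have H2 : (\sum_w X w ^+ m) / t ^+ m <= #|T|%:R by rewrite ler_pdivrMr ?exprn_gt0.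
have H3 : m%:R * ((\sum_w X w) / t) <= m%:R * #|T|%:R.
  apply: le_trans H _; rewrite -[(m%:R - 1) *+ _]mulr_natr; lra.
by rewrite ler_pM2l // ler_pdivrMr in H3.
Qed.

(** * Comparison of [mu] with the degree and the trace *)

Section Mu.
Variables (V : finType) (d n : nat) (sigma : 'I_d -> {perm V}).
Variable p : {ffun 'I_d -> 'S_n}.

Lemma card_letter : #|{: letter d}| = (2 * d)%N.
Proof. by rewrite card_prod card_ord card_bool mulnC. Qed.

(** Evaluate the eigenvalue equation where [|F|] is maximal. *)
Lemma new_eigenvalue_norm_le a : new_eigenvalues R sigma p a ->
  `|a| <= (2 * d)%:R.
Proof.
move=> [f [f0 _ eig]]; pose F x := f (enum_rank x) 0.
have Feig x : \sum_(s : letter d) F (letter_perm (lift_perms sigma p) s x) = a * F x.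
  by rewrite -adjacency_mxE eig mxE.
have /matrix0Pn [i [j fij]] := f0.
have y0 : F (enum_val i) != 0 by rewrite /F enum_valK -(ord1 j).
case: (@Order.TotalTheory.arg_maxP _ _ _ (enum_val i) xpredT (fun x => `|F x|) isT) => x _ xmax.
have Fx : 0 < `|F x| by apply: lt_le_trans (xmax _ isT); rewrite normr_gt0; exact: y0.
rewrite -(ler_pM2r Fx) -normrM -Feig; apply: le_trans (ler_norm_sum _ _ _) _.
apply: (@le_trans _ _ (\sum_(s : letter d) `|F x|)).
  by apply: ler_sum => s _; exact: xmax.
by rewrite sumr_const card_letter mulr_natl.
Qed.

Lemma mu_le t : 0 <= t -> (forall a, new_eigenvalues R sigma p a -> `|a| <= t) ->
  mu R sigma p <= t.
Proof.
move=> t0 H; rewrite /mu; set A := (X in sup X).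
have [->|A0] := eqVneq A set0; first by rewrite sup0.
by apply: ge_sup; [exact/set0P | move=> _ [a Ha <-]; exact: H].
Qed.

Lemma mu_ge0 : 0 <= mu R sigma p.
Proof.
rewrite /mu; set A := (X in sup X).
have [->|/set0P[x Ax]] := eqVneq A set0; first by rewrite sup0.
apply: (@le_trans _ _ x); first by case: Ax => a _ <-.
(* The degree bound ensures that [sup] is taken over a bounded set. *)
apply: ub_le_sup => //; exists (2 * d)%:R => _ [a Ha <-].
exact: new_eigenvalue_norm_le.
Qed.

Lemma mu_le_degree : mu R sigma p <= (2 * d)%:R.
Proof. by apply: mu_le => // a; exact: new_eigenvalue_norm_le. Qed.

Lemma mu_le_new_trace k : (0 < n)%N -> (0 < k)%N ->
  mu R sigma p ^+ (2 * k) <= new_trace R sigma p k.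
Proof.
move=> n0 k0; set S := new_trace _ _ _ _.
have S0 : 0 <= S by exact: new_trace_ge0.
pose t := S `^ (2 * k)%:R^-1.
have tS : t ^+ (2 * k) = S.
  rewrite -powR_mulrn ?powR_ge0 // -powRrM mulVf ?powRr1 //.
  by rewrite pnatr_eq0 muln_eq0 negb_or /= -lt0n.
have k2 : (0 < 2 * k)%N by rewrite muln_gt0.
rewrite -tS lerXn2r ?nnegrE ?mu_ge0 ?powR_ge0 //.
apply: mu_le => [|a Ha]; first exact: powR_ge0.
rewrite -(ler_pXn2r k2) ?nnegrE ?powR_ge0 // tS.
apply: le_trans (new_eigenvalue_le k n0 Ha).
by rewrite !exprM real_normK ?num_real.
Qed.

End Mu.

End Moments.

(** * Expected fixed points and the averaged trace *)

Section ExpectedTrace.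
Variables (R : realType) (d n : nat).
Local Notation perms := {ffun 'I_d -> 'S_n}.
Hypothesis n_gt0 : (0 < n)%N.

Lemma sum_fixpoints_primitive_le (s0 : letter d) b L :
  path.cycle (@nonbacktracking d) b -> (0 < size b <= L)%N -> primitive_word b ->
  (2 * L ^ 2 <= n)%N ->
  \sum_(p : perms) #|fixpoints p b|%:R
    <= (1 + 4 * (L ^ 4)%:R / n%:R) * #|{: perms}|%:R :> R.
Proof.
set m := size b => cyc /andP[m0 mL] prim Ln.
have := card_closed_walks s0 (Ordinal n_gt0) cyc m0 prim.
rewrite -/m -natr_sum; set S := (\sum_p _)%N; set N := #|_| => H.
have n0 : 0 < n%:R :> R by rewrite ltr0n.
have nV : n%:R != 0 :> R by rewrite gt_eqF.
have mn : (m <= n)%N by nia.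
pose y : R := (m ^ 2)%:R / n%:R; pose z : R := (m ^ 4)%:R / n%:R.
have y0 : 0 <= y by rewrite divr_ge0.
have z0 : 0 <= z by rewrite divr_ge0.
have y2 : y <= 1 / 2.
  rewrite ler_pdivrMr // mul1r mulrC ler_pdivlMr // -natrM ler_nat; nia.
have bern : 1 - y <= (1 - m%:R / n%:R) ^+ m.
  have h : -1 <= - (m%:R / n%:R) :> R.
    by rewrite lerN2 ler_pdivrMr // mul1r ler_nat.
  apply: le_trans (bernoulli_le m h).
  by rewrite mulrN mulrA -natrM mulnn.
have main : S%:R * (1 - y) <= (1 + z) * N%:R :> R.
  have nm : 0 < n%:R ^+ m :> R by rewrite exprn_gt0.
  rewrite -(ler_pM2r nm).
  apply: (@le_trans _ _ (S * (n - m) ^ m)%N%:R).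
    rewrite natrM natrX natrB // -mulrA ler_wpM2l //.
    have -> : n%:R - m%:R = (1 - m%:R / n%:R) * n%:R :> R.
      by rewrite mulrBl mul1r divfK.
    by rewrite exprMn ler_wpM2r // ltW.
  have -> : (1 + z) * N%:R * n%:R ^+ m = ((n ^ m + m ^ 4 * n ^ m.-1) * N)%N%:R :> R.
    rewrite natrM natrD natrM !natrX /z -[in n%:R ^+ m](prednK m0) exprS natrX.
    by field.
  by rewrite ler_nat.
have yL : y <= (L ^ 4)%:R / n%:R.
  rewrite ler_wpM2r ?invr_ge0 ?ler0n // ler_nat.
  apply: (@leq_trans (m ^ 4)); first by rewrite leq_pexp2l.
  by rewrite leq_exp2r.
have zL : z <= (L ^ 4)%:R / n%:R.
  by rewrite ler_wpM2r ?invr_ge0 ?ler0n // ler_nat leq_exp2r.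
have N0 : 0 <= N%:R :> R by [].
(* For [y <= 1 / 2], [(1 + z) / (1 - y) <= 1 + 2 * y + 2 * z]. *)
apply: (@le_trans _ _ ((1 + 2 * y + 2 * z) * N%:R)); last first.
  by rewrite ler_wpM2r // -mulrA; lra.
have y1 : 0 < 1 - y by lra.
rewrite -(ler_pM2r y1); apply: le_trans main _.
rewrite mulrAC ler_wpM2r //; nra.
Qed.

Lemma sum_fixpoints_le (s0 : letter d) w L : ~ power_word s0 w ->
  (size w <= L)%N -> (2 * L ^ 2 <= n)%N ->
  \sum_(p : perms) #|fixpoints p w|%:R
    <= (1 + 4 * (L ^ 4)%:R / n%:R) * #|{: perms}|%:R :> R.
Proof.
move=> npw wL Ln; have [//|[u [b [rw cyc b0 prim]]]] := reduced_form_dichotomy s0 w.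
under eq_bigr => p _ do rewrite (card_fixpoints_conj p rw).
apply: (sum_fixpoints_primitive_le s0) => //; rewrite b0 /=.
by apply: leq_trans wL; apply: leq_trans (size_red w); rewrite rw !size_cat; lia.
Qed.

(** Power words are bounded by [n] fixed points, all others by the expectation bound with
    [L = 2 * k], whose condition [2 * L ^ 2 <= n] reads [8 * k ^ 2 <= n]. *)
Lemma sum_new_trace_le (V : finType) (sigma : 'I_d -> {perm V}) (s0 : letter d) k :
  (8 * k ^ 2 <= n)%N ->
  \sum_(p : perms) new_trace R sigma p k <= #|{: perms}|%:R * (#|V|%:R *
    (((2 * k).+1 ^ 3 * (8 * d) ^ k * n)%:R +
     ((2 * d) ^ (2 * k))%:R * (4 * ((2 * k) ^ 4)%:R / n%:R))).
Proof.
move=> kn; set N := #|{: perms}|; set delta := 4 * _ / _.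
have delta0 : 0 <= delta by rewrite divr_ge0 // mulr_ge0.
pose A := [set ww : k.-tuple (letter d) * k.-tuple (letter d) |
  `[< power_word s0 (ww.1 ++ winv ww.2) >]]%SET.
have cA : (#|A| <= (2 * k).+1 ^ 3 * (8 * d) ^ k)%N.
  by apply: (@card_power_pairs _ s0) => ww; rewrite inE => /asboolP.
pose B ww : R := (ww \in A)%:R * n%:R + delta.
have B0 ww : 0 <= B ww by rewrite addr_ge0 // mulr_ge0.
have pairB (w w' : k.-tuple (letter d)) :
    \sum_(p : perms) (#|[set v | walk sigma w v == walk sigma w' v]%SET|%:R *
      (#|fixpoints p (w ++ winv w')|%:R - 1)) <= N%:R * (#|V|%:R * B (w, w')).
  rewrite -mulr_sumr sumrB sumr_const -/N.
  apply: (@le_trans _ _ (#|[set v | walk sigma w v == walk sigma w' v]%SET|%:R *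
      (N%:R * B (w, w')))); last first.
    by rewrite mulrCA ler_wpM2l // ler_wpM2r // ler_nat max_card.
  rewrite ler_wpM2l // lerBlDr /B inE /=; case: asboolP => pw.
    apply: (@le_trans _ _ (N%:R * n%:R)); last first.
      by rewrite mul1r mulrDr -addrA lerDl addr_ge0 ?mulr_ge0.
    apply: (@le_trans _ _ (\sum_(p : perms) n%:R)).
      by apply: ler_sum => p _; rewrite ler_nat -[X in (_ <= X)%N]card_ord max_card.
    by rewrite sumr_const -/N mulr_natl.
  rewrite mul0r add0r.
  have -> : N%:R * delta + N%:R = (1 + delta) * N%:R by rewrite mulrDl mul1r addrC mulrC.
  apply: (sum_fixpoints_le pw); last by lia.
  by rewrite size_cat size_winv !size_tuple; lia.
rewrite /new_trace exchange_big /=.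
under eq_bigr => w _ do rewrite exchange_big /=.
apply: (@le_trans _ _ (\sum_w \sum_w' N%:R * (#|V|%:R * B (w, w')))).
  by apply: ler_sum => w _; apply: ler_sum => w' _; exact: pairB.
under eq_bigr => w _ do rewrite -!mulr_sumr.
rewrite -!mulr_sumr ler_wpM2l // ler_wpM2l // pair_bigA /=.
under eq_bigr => ww _ do rewrite -surjective_pairing.
rewrite /B big_split /= -mulr_suml sumr_const; apply: lerD.
  rewrite natrM ler_wpM2r // -natr_sum ler_nat.
  apply: leq_trans cA; rewrite -sum1_card [X in (_ <= X)%N]big_mkcond /=.
  by apply: leq_sum => ww _; case: (_ \in _).
by rewrite card_prod card_tuple card_letter -expnD addnn -mul2n mulr_natl.
Qed.

End ExpectedTrace.

(** * Asymptotics *)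

Local Open Scope classical_set_scope.
Local Open Scope ring_scope.

Section Asymptotics.
Variables (R : realType) (d : nat).

Definition broder_shamir_bound : R := 32 `^ (1 / 4) * d%:R `^ (3 / 4).
Local Notation c := broder_shamir_bound.

Lemma broder_shamir_bound_ge0 : 0 <= c.
Proof. by rewrite mulr_ge0 ?powR_ge0. Qed.

Lemma broder_shamir_bound_gt0 : (0 < d)%N -> 0 < c.
Proof. by move=> d0; rewrite mulr_gt0 ?powR_gt0 ?ltr0n. Qed.

Lemma broder_shamir_bound4 : c ^+ 4 = 32 * d%:R ^+ 3.
Proof.
have four : 4 != 0 :> R by rewrite pnatr_eq0.
rewrite exprMn -!powR_mulrn ?powR_ge0 // -!powRrM !divfK //.
by rewrite powRr1.
Qed.

(** In fourth powers: [16 * d ^ 4 <= 32 * d ^ 3]. *)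
Lemma degree_le_bound : (d <= 2)%N -> (2 * d)%:R <= c.
Proof.
move=> d2; rewrite -(@ler_pXn2r _ 4) ?nnegrE ?broder_shamir_bound_ge0 //.
rewrite broder_shamir_bound4 -!natrX -natrM ler_nat expnMn expnS mulnA leq_mul2r.
by rewrite (_ : 2 ^ 4 * d <= 32)%N ?orbT //; lia.
Qed.

Lemma moment_bound (V : finType) (sigma : 'I_d -> {perm V}) (eps : R) k1 :
  (2 < d)%N -> 0 < eps ->
  exists n0, forall n, (n0 <= n)%N -> exists k, [/\ (k1 <= k)%N, (0 < k)%N &
    \sum_(p : {ffun 'I_d -> 'S_n}) mu R sigma p ^+ (2 * k)
    <= #|{: {ffun 'I_d -> 'S_n}}|%:R * ((1 + eps) * c) ^+ (2 * k)].
Proof.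
move=> d2 eps0; pose q : R := d%:R / 2.
have dR : 3 <= d%:R :> R by rewrite (ler_nat _ 3).
have q1 : 1 < q by rewrite ltr_pdivlMr // mul1r (lt_le_trans _ dR) // ltr_nat.
have q0 : 0 < q by apply: lt_trans q1.
(* The constant [64 * q] will give [64 * k ^ 4 * q <= q ^+ k <= n ^ 2 * q], hence
   [8 * k ^ 2 <= n]. *)
have q64 : 0 <= 64 * q by rewrite mulr_ge0 // ltW.
have [ka kaP] := quartic_le_exp q1 q64.
have e1 : 1 < (1 + eps) ^+ 2 by rewrite exprn_egt1 // ltrDl.
pose K : R := #|V|%:R * (1 + 4 * q).
have K0 : 0 <= K by rewrite mulr_ge0 // addr_ge0 // mulr_ge0 // ltW.
have [kb kbP] := quartic_le_exp e1 K0.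
pose k2 := (k1 + ka + kb + 1)%N.
have qk2 : 0 <= q ^+ k2 by rewrite exprn_ge0 // ltW.
(* For [n > q ^+ k2] the least [k] with [n ^ 2 <= q ^+ k] is at least [k2]. *)
exists (Num.bound (q ^+ k2)).+1 => n nn.
have n0 : (0 < n)%N by apply: leq_trans nn.
have nR : 1 <= n%:R :> R by rewrite (ler_nat _ 1).
have nq : q ^+ k2 < n%:R.
  by apply: lt_le_trans (archi_boundP qk2) _; rewrite ler_nat ltnW.
have exk : exists k, n%:R ^+ 2 <= q ^+ k :> R.
  have [kc kcP] := quartic_le_exp q1 (sqr_ge0 (n%:R : R)).
  exists kc; apply: le_trans (kcP _ (leqnn _)).
  by rewrite ler_peMr ?sqr_ge0 // ler1n expn_gt0.
case: (ex_minnP exk) => k nk kmin.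
have k2k : (k2 <= k)%N.
  rewrite leqNgt; apply/negP => /ltnW kk2.
  have := le_trans nk (ler_weXn2l (ltW q1) kk2).
  apply/negP; rewrite -ltNge; apply: lt_le_trans nq _.
  by rewrite ler_eXnr.
have [k1k kak kbk k0] : [/\ k1 <= k, ka <= k, kb <= k & 0 < k]%N.
  by clear -k2k; rewrite /k2 in k2k; split; lia.
have qkn : q ^+ k <= n%:R ^+ 2 * q.
  have : ~~ (n%:R ^+ 2 <= q ^+ k.-1 :> R).
    by apply/negP => /kmin; rewrite leqNgt ltn_predL k0.
  rewrite -ltNge => /ltW h; have -> : q ^+ k = q ^+ k.-1 * q.
    by rewrite -exprSr prednK.
  by rewrite ler_wpM2r // ltW.
have k8 : (8 * k ^ 2 <= n)%N.
  rewrite -(@ler_nat R) -(@ler_pXn2r _ 2) ?nnegrE //.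
  rewrite -(ler_pM2r q0); apply: le_trans qkn; apply: le_trans (kaP k kak).
  rewrite [64 * q * _]mulrAC ler_pM2r // -natrX -natrM ler_nat.
  rewrite expnMn -expnM leq_mul // leq_exp2r //; clear; lia.
exists k; split=> //.
have d0 : (0 < d)%N by apply: ltn_trans d2.
apply: (@le_trans _ _ (\sum_(p : {ffun 'I_d -> 'S_n}) new_trace R sigma p k)).
  by apply: ler_sum => p _; exact: mu_le_new_trace.
apply: le_trans (sum_new_trace_le R n0 sigma (Ordinal d0, true) k8) _.
rewrite ler_wpM2l //.
pose W : R := (8 * d%:R) ^+ k * n%:R.
have W0 : 0 <= W by rewrite mulr_ge0 // exprn_ge0 // mulr_ge0.
(* Squared: [(8 * d) ^ (2 * k) * n ^ 2] is at most [(64 * d ^ 2 * q) ^ k], and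
   [64 * d ^ 2 * q = 32 * d ^ 3]. *)
have Wc : W <= c ^+ (2 * k).
  rewrite -(@ler_pXn2r _ 2) ?nnegrE ?exprn_ge0 ?broder_shamir_bound_ge0 //.
  rewrite -exprM (_ : 2 * k * 2 = 4 * k)%N; last by rewrite mulnAC.
  rewrite [c ^+ _]exprM broder_shamir_bound4 exprMn -exprM mulnC exprM.
  apply: le_trans (ler_wpM2l _ nk) _; first by rewrite exprn_ge0 // exprn_ge0 // mulr_ge0.
  have -> : 32 * d%:R ^+ 3 = (8 * d%:R) ^+ 2 * q by rewrite /q; field.
  by rewrite [X in _ <= X]exprMn.
(* Here [(2 * d) ^ 2 = 8 * d * q], and minimality of [k] bounds [q ^+ k] by [n ^ 2 * q]. *)
have T2 : ((2 * d) ^ (2 * k))%:R / n%:R <= W * q.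
  rewrite ler_pdivrMr ?ltr0n //.
  have -> : ((2 * d) ^ (2 * k))%:R = (8 * d%:R) ^+ k * q ^+ k :> R.
    by rewrite -exprMn natrX exprM; congr (_ ^+ _); rewrite natrM /q; field.
  have -> : W * q * n%:R = (8 * d%:R) ^+ k * (n%:R ^+ 2 * q) by rewrite /W; ring.
  by rewrite ler_wpM2l // exprn_ge0 // mulr_ge0.
pose Q : R := ((2 * k).+1 ^ 4)%:R.
have Q3 : ((2 * k).+1 ^ 3)%:R <= Q by rewrite ler_nat leq_pexp2l.
have Q4 : ((2 * k) ^ 4)%:R <= Q by rewrite ler_nat leq_exp2r.
apply: (@le_trans _ _ (#|V|%:R * (Q * W + 4 * (Q * (W * q))))).
  rewrite ler_wpM2l //; apply: lerD.
    rewrite -mulnA natrM; apply: ler_pM => //.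
    by rewrite natrM natrX natrM.
  move: Q4 T2; set x := ((2 * k) ^ 4)%:R; set y := ((2 * d) ^ (2 * k))%:R => Q4 T2.
  have -> : y * (4 * x / n%:R) = 4 * (x * (y / n%:R)) by ring.
  by rewrite ler_wpM2l // ler_pM // divr_ge0.
have -> : #|V|%:R * (Q * W + 4 * (Q * (W * q))) = K * Q * W by rewrite /K; ring.
rewrite exprMn; apply: ler_pM => //; first by rewrite mulr_ge0.
by rewrite [(1 + eps) ^+ _]exprM; exact: kbP.
Qed.

Lemma card_perms_gt0 n : 0 < #|{: {ffun 'I_d -> 'S_n}}|%:R :> R.
Proof. by rewrite ltr0n; apply/card_gt0P; exists [ffun=> 1%g]. Qed.

Lemma expectation_mu_le (V : finType) (sigma : 'I_d -> {perm V}) (e : R) :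
  (0 < d)%N -> 0 < e -> \forall n \near \oo,
  uniform_expectation (fun p : {ffun 'I_d -> 'S_n} => mu R sigma p) <= c + e.
Proof.
move=> d0 e0; have [d2|d2] := leqP d 2.
  apply: nearW => n; rewrite ler_pdivrMr ?card_perms_gt0 //.
  apply: (@le_trans _ _ (\sum_(p : {ffun 'I_d -> 'S_n}) c)).
    by apply: ler_sum => p _; apply: le_trans (mu_le_degree _ _ _) (degree_le_bound d2).
  by rewrite sumr_const -[c *+ _]mulr_natr ler_wpM2r // lerDl ltW.
have c0 := broder_shamir_bound_gt0 d0.
have [||n0 n0P] := @moment_bound V sigma (e / c) 0 => //; first by rewrite divr_gt0.
exists n0 => // n /= /n0P[k [_ k0 H]].
rewrite ler_pdivrMr ?card_perms_gt0 // mulrC.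
have -> : c + e = (1 + e / c) * c by rewrite mulrDl mul1r divfK // gt_eqF.
apply: (mean_le_moment (m := (2 * k)%N)) => //; first by rewrite muln_gt0.
  by rewrite mulr_gt0 // addr_gt0 // divr_gt0.
by move=> p; exact: mu_ge0.
Qed.

(** Markov's inequality for the moment of order [2 * k] with [eps = 1 / 2]: the failure probability
    is at most [(3 / 4) ^ (2 * k) = (9 / 16) ^ k]. *)
Lemma probability_mu_cvg (V : finType) (sigma : 'I_d -> {perm V}) : (0 < d)%N ->
  (fun n : nat => uniform_probability R
     (fun p : {ffun 'I_d -> 'S_n} => mu R sigma p <= 2 * c)) @ \oo --> (1 : R).
Proof.
move=> d0; have c0 := broder_shamir_bound_gt0 d0.
apply/cvgrPdist_le => e e0.
have [d2|d2] := leqP d 2.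
  apply: nearW => n; rewrite /uniform_probability.
  rewrite (eq_card (B := xpredT)) => [|p]; last first.
    have h : mu R sigma p <= 2 * c.
      rewrite (le_trans (mu_le_degree _ _ _)) // (le_trans (degree_le_bound d2)) //.
      by rewrite ler_peMl ?(ltW c0) // ler1n.
    exact: h.
  by rewrite divff ?gt_eqF ?card_perms_gt0 // subrr normr0 ltW.
have [||k1 k1P] := @quartic_le_exp R (16 / 9) e^-1; [lra|by rewrite invr_ge0 ltW|].
have [||n0 n0P] := @moment_bound V sigma (1 / 2) k1 => //.
exists n0 => // n /= /n0P[k [k1k k0 H]].
set N := #|_| in H; set E := (fun p => _).
have N0 : 0 < N%:R :> R by exact: card_perms_gt0.
have NE : #|E|%:R = N%:R - #|predC E|%:R :> R.
  by rewrite /N -(cardC E) natrD addrK.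
rewrite /uniform_probability -/N NE mulrBl divff ?gt_eqF // opprB addrC subrK.
rewrite ger0_norm ?divr_ge0 // ler_pdivrMr //.
have t0 : 0 < (2 * c) ^+ (2 * k) by rewrite exprn_gt0 // mulr_gt0.
have M : #|predC E|%:R * (2 * c) ^+ (2 * k) <= N%:R * ((1 + 1 / 2) * c) ^+ (2 * k).
  apply: le_trans H; rewrite mulr_natl -sumr_const.
  rewrite [X in _ <= X](bigID (predC E)) /= -[X in X <= _]addr0 lerD //; last first.
    by apply: sumr_ge0 => p _; rewrite exprn_ge0 // mu_ge0.
  apply: ler_sum => p; rewrite inE /= /E -ltNge => /ltW h.
  by rewrite lerXn2r ?nnegrE ?mu_ge0 ?mulr_ge0 // ltW.
rewrite -(ler_pM2r t0); apply: le_trans M _.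
have -> : e * N%:R * (2 * c) ^+ (2 * k) = N%:R * (e * 2 ^+ (2 * k) * c ^+ (2 * k)).
  by rewrite exprMn; ring.
rewrite ler_wpM2l // exprMn ler_wpM2r ?exprn_ge0 ?(ltW c0) //.
have q9 : (1 + 1 / 2) ^+ (2 * k) * (16 / 9) ^+ k = 2 ^+ (2 * k) :> R.
  by rewrite !exprM -exprMn; congr (_ ^+ _); field.
have ek : 1 <= e * (16 / 9) ^+ k.
  rewrite mulrC -ler_pdivrMr // mul1r; apply: le_trans (k1P k k1k).
  by rewrite ler_peMr ?invr_ge0 ?(ltW e0) // ler1n expn_gt0.
rewrite -q9 mulrCA ler_peMr // exprn_ge0 //; lra.
Qed.

End Asymptotics.

Theorem theorem5 (R : realType) :
  (forall (d : nat) (V : finType) (sigma : 'I_d -> {perm V}),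
     (1 <= d)%N ->
     exists o : nat -> R,
       o @ \oo --> (0 : R) /\
       forall n : nat,
         uniform_expectation (fun p : {ffun 'I_d -> 'S_n} => mu R sigma p)
           <= 32 `^ (1 / 4) * d%:R `^ (3 / 4) + o n)
  /\
  (exists C : R,
     forall (d : nat) (V : finType) (sigma : 'I_d -> {perm V}),
       (1 <= d)%N ->
       (fun n : nat =>
          uniform_probability R
            (fun p : {ffun 'I_d -> 'S_n} => mu R sigma p <= C * d%:R `^ (3 / 4)))
         @ \oo --> (1 : R)).
Proof.
split=> [d V sigma d1|].
  pose E n := uniform_expectation (fun p : {ffun 'I_d -> 'S_n} => mu R sigma p).
  (* The positive part of the excess makes the inequality hold for every [n], not only
     eventually. *)
  exists (fun n => Num.max 0 (E n - broder_shamir_bound R d)); split; last first.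
    by move=> n; rewrite -lerBlDl le_max lexx orbT.
  apply/cvgrPdist_le => e e0; near=> n.
  rewrite sub0r normrN ger0_norm ?le_max ?lexx // ge_max ltW //= lerBlDl.
  by near: n; exact: expectation_mu_le.
exists (2 * 32 `^ (1 / 4)) => d V sigma d1; rewrite -mulrA.
exact: probability_mu_cvg.
Unshelve. all: by end_near. Qed.
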